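(* Let $d\mu=e^{-U}d\lambda$ be a probability measure on a nilpotent Lie group with sub-gradient $\nabla$, and let $\mathcal{W}$ be a non-negative differentiable function such that for some $a\in(0,\infty)$ $$\mu(\mathcal{W}f^2)\le a\left(\mu|\nabla f|^2+\mu f^2\right)$$ for all $f$ for which the right-hand side is well defined. Let $n\in\mathbb{N}$. Suppose that outside a ball $B_R$ there exist $\varepsilon\equiv\varepsilon(R)\in(0,\infty)$ and a constant $E_\varepsilon\in(0,\infty)$ such that, wherever $\mathcal{W}\neq0$, $$\frac{1}{\mathcal{W}}|\nabla\mathcal{W}|^2\le\varepsilon\,\mathcal{W}^2+E_\varepsilon .$$ If $\varepsilon a\frac{n^2}{2}<1$, then for every $m\le n$ there exists a constant $a_m\in(0,\infty)$ such that $$\mu\left(\mathcal{W}^mf^2\right)\le a_m\,\mu\left(\sum_{k=1}^m|\nabla^kf|^2+f^2\right)$$ for all $f$ for which the right-hand side is well defined.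
   Context: $\mu g=\int g\,d\mu$; $\lambda$ is the Haar (Lebesgue) measure. The sub-gradient is $\nabla=(X_1,\dots,X_d)$, where $X_1,\dots,X_d$ are left-invariant vector fields generating the nilpotent Lie algebra. $|\nabla f|^2=\sum_i|X_if|^2$, and $|\nabla^kf|^2$ is the squared length of the $k$-fold iterated sub-gradient, $|\nabla^kf|^2=\sum_{i_1,\dots,i_k}|X_{i_1}\cdots X_{i_k}f|^2$. $B_R$ is a ball of radius $R$ (with respect to a homogeneous norm on the group). *)

(* Defs.v *)
From HB Require Import structures.
From mathcomp Require Import all_boot all_order all_algebra.
From mathcomp Require Import all_classical all_reals all_analysis.

Set Implicit Arguments.
Unset Strict Implicit.
Unset Printing Implicit Defensive.

Import Order.TTheory GRing.Theory Num.Theory.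
Import numFieldNormedType.Exports.

Local Open Scope classical_set_scope.
Local Open Scope ring_scope.

(* The usual class C^k when V is finite-dimensional: all iterated            *)
(* directional derivatives of order < k are (Frechet) differentiable and     *)
(* those of order k are continuous.                                          *)
Fixpoint Ck (R : realType) (V W : normedModType R) (k : nat) (f : V -> W)
    : Prop :=
  match k with
  | 0 => continuous f
  | k'.+1 => (forall x, differentiable f x) /\
             (forall v, Ck k' (fun x => 'D_v f x))
  end.

Definition smooth (R : realType) (V W : normedModType R) (f : V -> W) : Prop :=
  forall k, Ck k f.

Definition diag_dilation (R : realType) (N : nat) (w : 'I_N -> R) (r : R)
    (x : 'rV[R]_N) : 'rV[R]_N :=
  \row_j (r `^ w j * x ord0 j).

(* A nilpotent Lie group that carries a homogeneous norm carries dilations,  *)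
(* so it is simply connected and is R^N with a smooth group law; coordinates *)
(* are chosen so that the dilations are diagonal, which forces the identity  *)
(* to be the origin.                                                         *)
Record homogeneousGroup (R : realType) (N : nat) := HomogeneousGroup {
  gmul : 'rV[R]_N -> 'rV[R]_N -> 'rV[R]_N;
  ginv : 'rV[R]_N -> 'rV[R]_N;
  weight : 'I_N -> R;
  gmulA : associative gmul;
  gmul0 : right_id 0 gmul;
  g0mul : left_id 0 gmul;
  gmulV : right_inverse 0 ginv gmul;
  gVmul : left_inverse 0 ginv gmul;
  gmul_smooth : smooth (fun z : 'rV[R]_N * 'rV[R]_N => gmul z.1 z.2);
  ginv_smooth : smooth ginv;
  (* for some s, all left-normed commutators [..[[x, y1], y2],.., ys] vanish *)
  gnilpotent : exists s : nat, forall (x : 'rV[R]_N) (ys : s.-tuple 'rV[R]_N),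
    foldl (fun u v => gmul (gmul u v) (gmul (ginv u) (ginv v))) x ys = 0;
  weight_gt0 : forall j, 0 < weight j;
  gdilationM : forall (r : R) (x y : 'rV[R]_N), 0 < r ->
    diag_dilation weight r (gmul x y) =
    gmul (diag_dilation weight r x) (diag_dilation weight r y)
}.

Section HomogeneousGroup.
Context (R : realType) (N : nat) (G : homogeneousGroup R N).
Local Notation V := 'rV[R]_N.

Definition homogeneous_norm (nu : V -> R) : Prop :=
  [/\ continuous nu,
      forall x, 0 <= nu x,
      forall x, nu x = 0 <-> x = 0 &
      forall (r : R) (x : V), 0 < r ->
        nu (diag_dilation (weight G) r x) = r * nu x].

Definition hball (nu : V -> R) (r : R) : set V := [set x | nu x < r].

Definition left_invariant (X : V -> V) : Prop :=
  forall x y, X (gmul G x y) = 'D_(X y) (gmul G x) y.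

Definition lie_bracket (X Y : V -> V) : V -> V :=
  fun x => 'D_(X x) Y x - 'D_(Y x) X x.

Definition lie_subalgebra (L : set (V -> V)) : Prop :=
  [/\ L (fun _ => 0),
      forall X Y, L X -> L Y -> L (fun x => X x + Y x),
      forall (c : R) X, L X -> L (fun x => c *: X x) &
      forall X Y, L X -> L Y -> L (lie_bracket X Y)].

(* A left-invariant field X is given by its one-parameter subgroup           *)
(* g t = exp (t X).                                                          *)
Definition one_parameter_subgroup (g : R -> V) : Prop :=
  (forall s t, g (s + t) = gmul G (g s) (g t)) /\
  (forall t, derivable g t 1).

Definition lfield (g : R -> V) : V -> V :=
  fun x => derive1 (fun t => gmul G x (g t)) 0.

Definition generating (d : nat) (g : 'I_d -> R -> V) : Prop :=
  smallest lie_subalgebra [set lfield (g i) | i in [set: 'I_d]] =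
  [set X | left_invariant X].

Definition along (g : R -> V) (f : V -> R) (x : V) : R -> R :=
  fun t => f (gmul G x (g t)).

(* X f (x) = d/dt f (x * exp (t X)) at t = 0 *)
Definition lderive (g : R -> V) (f : V -> R) : V -> R :=
  fun x => derive1 (along g f x) 0.

Section SubGradient.
Context (d : nat) (g : 'I_d -> R -> V).

(* lderives [:: i1; ..; ik] f = X_i1 (.. (X_ik f)) *)
Definition lderives (I : seq 'I_d) (f : V -> R) : V -> R :=
  foldr (fun i h => lderive (g i) h) f I.

Definition subgrad_sq (f : V -> R) (x : V) : R :=
  \sum_(i < d) (lderive (g i) f x) ^+ 2.

Definition subgradn_sq (k : nat) (f : V -> R) (x : V) : R :=
  \sum_(I : k.-tuple 'I_d) (lderives I f x) ^+ 2.

End SubGradient.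

Definition borelV : measurableType _ := g_sigma_algebraType (@open V).

(* The functions for which |nabla f|^2, .., |nabla^m f|^2 and their          *)
(* integrals (in [0, +oo]) are defined: all X_i1 .. X_ik f with k <= m exist *)
(* everywhere. Measurability of these derivatives follows from that of f.    *)
Definition subgrad_defined (d : nat) (g : 'I_d -> R -> V) (m : nat)
    (f : V -> R) : Prop :=
  measurable_fun [set: borelV] (f : borelV -> R) /\
  forall (I : seq 'I_d) (i : 'I_d) (x : V), (size I < m)%N ->
    derivable (along (g i) (lderives g I f) x) 0 1.

Definition haar_measure (lambda : {measure set borelV -> \bar R}) : Prop :=
  [/\ forall (x : V) (A : set borelV), measurable A ->
        lambda [set gmul G x y | y in A] = lambda A,
      forall K : set V, compact K -> (lambda K < +oo)%E &
      lambda [set: borelV] != 0%E].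

Definition has_density (lambda : {measure set borelV -> \bar R})
    (U : V -> R) (mu : probability borelV R) : Prop :=
  measurable_fun [set: borelV] (U : borelV -> R) /\
  forall A : set borelV, measurable A ->
    mu A = (\int[lambda]_(x in A) (expR (- U x))%:E)%E.

End HomogeneousGroup.

(* Main.v *)
Require Import Defs.
From HB Require Import structures.
From mathcomp Require Import all_boot all_order all_algebra.
From mathcomp Require Import all_classical all_reals all_analysis.
From mathcomp Require Import measurable_realfun.
From mathcomp Require Import ring lra.
Import Order.TTheory GRing.Theory Num.Theory.
Import numFieldNormedType.Exports.
Local Open Scope classical_set_scope.
Local Open Scope ring_scope.

(** The proof is by induction on m.  Write p = m - 1.  Formally one applies the
    hypothesis on mu (W f^2) to W^(p/2) f.  By the product rule and
    (x + y)^2 <= 2 x^2 + 2 y^2, the gradient term is at most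
      2 W^p |grad f|^2 + (p^2/2) W^(p-2) |grad W|^2 f^2,
    and |grad W|^2 <= W (eps W^2 + E_eps) bounds the second summand by
    (p^2/2) eps W^m f^2 plus a multiple of W^(m-2) f^2.  As
    a eps p^2/2 <= a eps n^2/2 < 1, the multiple of mu (W^m f^2) is absorbed by
    the left-hand side; the induction hypothesis, applied to f and to every
    X_i f, controls what is left.

    Two points need care.  The absorption requires mu (W^m f^2) to be finite,
    and the bound on grad W is available only outside a ball; besides, W^(p/2)
    need not be differentiable at the zeros of W.  All this is handled by using
    phi(W) f instead of W^(p/2) f, where
      phi(w) = (1 - M/w)_+^2 v(w)^p,   v(w) = sqrt w / (1 + dl w)
    with dl > 0, and M >= 1 is a bound for W on the ball; such an M exists since
    a ball of a homogeneous norm is bounded for the coordinates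
    (continuous_hball_bounded).  The function phi is differentiable, vanishes
    for w <= M, satisfies w phi(w)^2 <= dl^(-m), and |w v'(w)| <= v(w)/2, so
    that the damping by 1 + dl w does not increase the constant p^2/2.  The
    derivative of the factor (1 - M/w)_+^2 contributes lower-order terms only;
    the inequality (x + y + z)^2 <= 4 x^2 + 2 y^2 + 4 z^2, with the derivative
    of v^p in y, keeps the factor 2 on the critical term.  The outcome is the
    pointwise estimate subgrad_sq_cutoff_mul_le and, after absorption, a bound on
    mu (W phi(W)^2 f^2) uniform in dl (truncated_bound).

    With dl = 1/(k+1), the function W^m f^2 is dominated on {W <= k+1} by a
    combination of f^2 and W phi(W)^2 f^2 with coefficients independent of k,
    and monotone convergence along these sets gives the bound for m
    (power_boundS). *)

Set Implicit Arguments.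
Unset Strict Implicit.
Unset Printing Implicit Defensive.

(** * The cutoff function *)

Section Cutoff.
Context {R : realType}.
Implicit Types w y dl M : R.

(** The square root, damped at infinity; for w <= 0 its value is 0. *)
Definition damped_sqrt dl w : R := Num.sqrt w / (1 + dl * w).

(** A differentiable substitute for w^(p/2): it vanishes for w <= M, and its
    square is O(1/w) at infinity when p > 0 and dl > 0.  With the convention
    0^-1 = 0 and for p > 0 it also vanishes for w <= 0, because damped_sqrt
    does. *)
Definition cutoff M dl (p : nat) w : R :=
  Num.max 0 (1 - M / w) ^+ 2 * damped_sqrt dl w ^+ p.

(** The part of the derivative of the cutoff that comes from differentiating
    damped_sqrt^p; the remaining part is dcutoff_edge. *)
Definition dcutoff_power M dl (p : nat) w : R :=
  Num.max 0 (1 - M / w) ^+ 2 *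
  (p%:R * damped_sqrt dl w ^+ p.-1 *
   (damped_sqrt dl w * ((1 - dl * w) / (2 * w * (1 + dl * w))))).

(** The part of the derivative of the cutoff that comes from differentiating
    (1 - M/w)_+^2. *)
Definition dcutoff_edge M dl (p : nat) w : R :=
  2 * Num.max 0 (1 - M / w) * (M / w ^+ 2) * damped_sqrt dl w ^+ p.

Lemma is_derive_sqr_pos y :
  is_derive y 1 (fun z => Num.max 0 z ^+ 2) (2 * Num.max 0 y).
Proof.
have [y0|y0|->] := ltgtP y 0.
- rewrite mulr0; apply: (@near_eq_is_derive _ _ _ (cst 0)) => //.
  near=> z; rewrite /= max_l ?expr0n//.
  by apply: ltW; near: z; exact: lt_nbhsl.
- have h : is_derive y 1 ((@id R) ^+ 2) (2 * y).
    by apply: is_derive_eq; rewrite expr1 /GRing.scale/= mulr1.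
  apply: (near_eq_is_derive _ h).
  near=> z; rewrite fctE max_r//.
  by apply: ltW; near: z; exact: lt_nbhsr.
- suff H : (h : R)^-1 *: (Num.max 0 (h *: (1:R) + 0) ^+ 2 - Num.max 0 (0 : R) ^+ 2)
            @[h --> 0^'] --> (0 : R).
    rewrite mulr0; apply: DeriveDef; first by apply/cvg_ex; exists 0.
    exact/cvg_lim.
  apply/cvgr0Pnorm_le => e e0; near=> h.
  have hn0 : h != 0 by near: h; exact: nbhs_dnbhs_neq.
  have he : `|h| <= e by near: h; exact: dnbhs0_le.
  rewrite maxxx expr0n/= subr0 addr0 /GRing.scale/= mulr1.
  rewrite normrM normfV ler_pdivrMl ?normr_gt0// normrX expr2.
  have mh : `|Num.max 0 h| <= `|h| by rewrite maxEle; case: ifPn; rewrite ?normr0.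
  by apply: ler_pM => //; exact: le_trans mh he.
Unshelve. all: by end_near. Qed.

Lemma is_derive_damped_sqrt dl w : 0 <= dl -> 0 < w ->
  is_derive w 1 (damped_sqrt dl)
    (damped_sqrt dl w * ((1 - dl * w) / (2 * w * (1 + dl * w)))).
Proof.
move=> dl0 w0.
have q0 : 0 < 1 + dl * w by rewrite ltr_pwDl// mulr_ge0// ltW.
have s0 : 0 < Num.sqrt w by rewrite sqrtr_gt0.
rewrite /damped_sqrt.
have h1 : is_derive w 1 (fun z : R => 1 + dl * z) dl.
  by apply: is_derive_eq; rewrite /GRing.scale/=; ring.
have h2 := @is_deriveV R (fun z => 1 + dl * z) w dl 1 (lt0r_neq0 q0) h1.
have h3 := is_derive1_sqrt w0.
have h4 := is_deriveM h3 h2; apply: (is_derive_eq h4).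
rewrite /GRing.scale/=.
move: (sqr_sqrtr (ltW w0)) q0 s0; move: (Num.sqrt w) => s {h1 h2 h3 h4} <- q0 s0.
by field; rewrite (gt_eqF s0) gt_eqF.
Qed.

Lemma cutoff_eq0 M dl p w : 0 < M -> (0 < p)%N -> w <= M -> cutoff M dl p w = 0.
Proof.
move=> M0 p0 wM; rewrite /cutoff /damped_sqrt.
have [w0|w0] := leP w 0.
  by rewrite (ler0_sqrtr w0) mul0r (expr0n _ p) (gtn_eqF p0) mulr0.
by rewrite max_l ?expr0n ?mul0r// subr_le0 ler_pdivlMr// mul1r.
Qed.

Lemma is_derive_cutoff_gt M dl p w : 0 < M -> 0 <= dl -> M <= w ->
  is_derive w 1 (cutoff M dl p) (dcutoff_power M dl p w + dcutoff_edge M dl p w).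
Proof.
move=> M0 dl0 Mw; have w0 : 0 < w := lt_le_trans M0 Mw.
have h1 : is_derive w 1 (fun z : R => 1 - M / z) (M / w ^+ 2).
  have h := @is_deriveV R id w 1 1 (lt0r_neq0 w0) (is_derive_id _ _).
  have h' := is_deriveB (is_derive_cst (1:R) w 1) (is_deriveZ M h).
  by apply: (is_derive_eq h'); rewrite /GRing.scale/=; field; rewrite gt_eqF.
have h2 := @is_derive1_comp R (fun z => Num.max 0 z ^+ 2) (fun z => 1 - M / z)
    w _ _ (is_derive_sqr_pos (1 - M / w)) h1.
have h3 := is_deriveX p (is_derive_damped_sqrt dl0 w0).
have h4 := is_deriveM h2 h3.
rewrite (_ : cutoff M dl p = ((fun z => Num.max 0 z ^+ 2) \o
    (fun z => 1 - M / z)) * damped_sqrt dl ^+ p); last first.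
  by apply/funext => z; rewrite /cutoff !fctE.
apply: (is_derive_eq h4); rewrite /dcutoff_power /dcutoff_edge/= !fctE /GRing.scale/=.
by congr (_ + _); rewrite mulrC.
Qed.

Lemma is_derive_cutoff_le M dl p w : 0 < M -> 0 <= dl -> (0 < p)%N -> w <= M ->
  is_derive w 1 (cutoff M dl p) 0.
Proof.
move=> M0 dl0 p0; rewrite le_eqVlt => /predU1P[->|wM].
  apply: (is_derive_eq (is_derive_cutoff_gt p M0 dl0 (lexx M))).
  by rewrite /dcutoff_power /dcutoff_edge divff ?gt_eqF// subrr maxxx; ring.
apply: (@near_eq_is_derive _ _ _ (cst 0)) => //.
near=> z; rewrite cutoff_eq0//.
by apply: ltW; near: z; exact: lt_nbhsl.
Unshelve. all: by end_near. Qed.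

Lemma continuous_cutoff M dl p : 0 < M -> 0 <= dl -> (0 < p)%N ->
  continuous (cutoff M dl p).
Proof.
move=> M0 dl0 p0 w; apply: differentiable_continuous; apply/derivable1_diffP.
have [wM|/ltW Mw] := leP w M.
  exact: (@ex_derive _ _ _ _ _ _ _ (is_derive_cutoff_le M0 dl0 p0 wM)).
exact: (@ex_derive _ _ _ _ _ _ _ (is_derive_cutoff_gt p M0 dl0 Mw)).
Qed.

Lemma damped_sqrt_sqr dl w : 0 <= w ->
  damped_sqrt dl w ^+ 2 = w / (1 + dl * w) ^+ 2.
Proof. by move=> w0; rewrite expr_div_n sqr_sqrtr. Qed.

Lemma cutoffE2 M dl p w : 0 <= w ->
  cutoff M dl p w ^+ 2 =
  Num.max 0 (1 - M / w) ^+ 4 * (w / (1 + dl * w) ^+ 2) ^+ p.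
Proof.
move=> w0; rewrite -damped_sqrt_sqr// /cutoff exprMn -!exprM.
by rewrite [(p * 2)%N]mulnC.
Qed.

Lemma max0_itv M w : 0 <= M -> 0 < w -> 0 <= Num.max 0 (1 - M / w) <= 1.
Proof.
by move=> M0 w0; rewrite le_max lexx/= ge_max ler01 gerBl divr_ge0// ltW.
Qed.

Lemma damped_le dl w : 0 <= dl -> 0 <= w -> w / (1 + dl * w) ^+ 2 <= w.
Proof.
move=> dl0 w0; rewrite ler_piMr// invf_le1 ?exprn_gt0 ?ltr_pwDl ?mulr_ge0//.
by rewrite exprn_ege1// lerDl mulr_ge0.
Qed.

Lemma cutoff_sqr_le M dl p w : 0 <= M -> 0 <= dl -> 0 < w ->
  cutoff M dl p w ^+ 2 <= w ^+ p.
Proof.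
move=> M0 dl0 w0; have w0' := ltW w0; rewrite cutoffE2//.
have /andP[m0 m1] := max0_itv M0 w0.
have q0 : 0 <= w / (1 + dl * w) ^+ 2 by rewrite divr_ge0// sqr_ge0.
rewrite -[leRHS]mul1r; apply: ler_pM; rewrite ?exprn_ge0//.
  exact: exprn_ile1.
by apply: lerXn2r; rewrite ?nnegrE//; exact: damped_le.
Qed.

(** This bound makes the quantity to be absorbed finite. *)
Lemma mul_cutoff_sqr_le M dl p w : 0 <= M -> 0 < dl -> (0 < p)%N -> 0 <= w ->
  w * cutoff M dl p w ^+ 2 <= dl ^- p.+1.
Proof.
case: p => // p M0 dl0 _; rewrite le_eqVlt => /predU1P[<-|w0].
  by rewrite mul0r invr_ge0 exprn_ge0// ltW.
have w0' := ltW w0; rewrite cutoffE2//.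
have /andP[m0 m1] := max0_itv M0 w0.
set q := 1 + dl * w; have q0 : 0 < q by rewrite ltr_pwDl// mulr_ge0// ltW.
have q1 : 1 <= q by rewrite lerDl mulr_ge0// ltW.
have wq : w / q <= dl^-1.
  by rewrite ler_pdivrMr// -ler_pdivrMl ?invr_gt0// invrK lerDr.
have wq0 : 0 <= w / q by rewrite divr_ge0// ltW.
have e : w * (w / q ^+ 2) ^+ p.+1 = (w / q) ^+ p.+2 * q^-1 ^+ p.
  have -> : w / q ^+ 2 = w / q * q^-1 by field; rewrite gt_eqF.
  rewrite -{1}(divfK (lt0r_neq0 q0) w) exprMn !exprS.
  by move: (w / q) => u; move: (u ^+ p) (q^-1 ^+ p) => b c; field; rewrite gt_eqF.
rewrite mulrCA e -[leRHS]mul1r -exprVn.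
have i0 : 0 <= q^-1 by rewrite invr_ge0 ltW.
apply: ler_pM.
- exact: exprn_ge0.
- by apply: mulr_ge0; exact: exprn_ge0.
- exact: exprn_ile1.
rewrite -[leRHS]mulr1; apply: ler_pM; rewrite ?exprn_ge0//.
  by apply: lerXn2r; rewrite ?nnegrE// invr_ge0 ltW.
by rewrite exprn_ile1// invf_le1.
Qed.

(** The logarithmic derivative of the damped square root is
    (1 - dl w) / (2 w (1 + dl w)), of absolute value at most 1/(2w): the
    constant is the one of w^(p/2) itself. *)
Lemma dcutoff_power_sqr_le M dl p w : 0 < w -> 0 <= dl ->
  (w * dcutoff_power M dl p w) ^+ 2 <= p%:R ^+ 2 / 4 * cutoff M dl p w ^+ 2.
Proof.
case: p => [|p] w0 dl0.
  by rewrite /dcutoff_power !mul0r !mulr0 !expr0n /= !mul0r lexx.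
set q := 1 + dl * w.
have q0 : 0 < q by rewrite ltr_pwDl// mulr_ge0// ltW.
have -> : w * dcutoff_power M dl p.+1 w =
    p.+1%:R / 2 * cutoff M dl p.+1 w * ((1 - dl * w) / q).
  rewrite /dcutoff_power /cutoff /= [_ ^+ p.+1]exprS -/q.
  move: (damped_sqrt dl w) (Num.max _ _) => v c; move: (v ^+ p) (p.+1%:R) => b r.
  by field; rewrite !gt_eqF.
have t1 : ((1 - dl * w) / q) ^+ 2 <= 1.
  have dw : 0 <= dl * w by rewrite mulr_ge0// ltW.
  rewrite -real_normK ?num_real// exprn_ile1// normrM normfV (gtr0_norm q0).
  rewrite ler_pdivrMr// mul1r.
  by rewrite ler_norml /q; apply/andP; split; lra.
rewrite exprMn -[leRHS]mulr1; apply: ler_pM; rewrite ?sqr_ge0//.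
by rewrite le_eqVlt; apply/orP; left; apply/eqP; field.
Qed.

Lemma dcutoff_edge_sqr_le M dl p w : 0 <= M -> 0 < w -> 0 <= dl ->
  (w * dcutoff_edge M dl p w) ^+ 2 <= 4 * (M / w) ^+ 2 * w ^+ p.
Proof.
move=> M0 w0 dl0; have /andP[m0 m1] := max0_itv M0 w0; have w0' := ltW w0.
rewrite /dcutoff_edge.
have -> : (w * (2 * Num.max 0 (1 - M / w) * (M / w ^+ 2) *
    damped_sqrt dl w ^+ p)) ^+ 2 =
  4 * (M / w) ^+ 2 * (Num.max 0 (1 - M / w) ^+ 2 * (damped_sqrt dl w ^+ 2) ^+ p).
  rewrite -!exprM mulnC exprM; move: (Num.max _ _) (damped_sqrt dl w ^+ p) => c b.
  by field; rewrite gt_eqF.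
apply: ler_wpM2l; first by rewrite mulr_ge0 ?sqr_ge0.
rewrite damped_sqrt_sqr// -[leRHS]mul1r.
have q0 : 0 <= w / (1 + dl * w) ^+ 2 by rewrite divr_ge0// sqr_ge0.
apply: ler_pM; rewrite ?exprn_ge0//; first exact: exprn_ile1.
by apply: lerXn2r; rewrite ?nnegrE//; exact: damped_le.
Qed.

(** Where dl w <= 1 the cutoff is comparable to w^(p/2), uniformly in dl. *)
Lemma le_cutoff_sqr M dl p w : 0 <= M -> 0 <= dl -> 0 < w -> 2 * M <= w ->
  dl * w <= 1 -> w ^+ p <= 16 * 4 ^+ p * cutoff M dl p w ^+ 2.
Proof.
move=> M0 dl0 w0 Mw dw; have w0' := ltW w0; rewrite cutoffE2//.
set q := 1 + dl * w.
have q0 : 0 < q by rewrite ltr_pwDl// mulr_ge0.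
have q2 : q ^+ 2 <= 4.
  have -> : 4 = 2 ^+ 2 :> R by rewrite -natrX.
  by apply: lerXn2r; rewrite ?nnegrE// ?(ltW q0)// /q; lra.
have m : 2^-1 <= Num.max 0 (1 - M / w).
  rewrite le_max; apply/orP; right.
  have : M / w <= 2^-1 by rewrite ler_pdivrMr//; lra.
  lra.
have m4 : 1 <= 16 * Num.max 0 (1 - M / w) ^+ 4.
  have : 2^-1 ^+ 4 <= Num.max 0 (1 - M / w) ^+ 4.
    by apply: lerXn2r => //; rewrite nnegrE ?invr_ge0// (le_trans _ m).
  rewrite -(ler_pM2l (_ : 0 < 16))//; apply: le_trans.
  by rewrite exprVn -natrX divff// pnatr_eq0.
have -> : 16 * 4 ^+ p * (Num.max 0 (1 - M / w) ^+ 4 * (w / q ^+ 2) ^+ p) =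
  16 * Num.max 0 (1 - M / w) ^+ 4 * (4 * (w / q ^+ 2)) ^+ p.
  by rewrite [X in _ = _ * X]exprMn mulrACA.
rewrite -[leLHS]mul1r; apply: ler_pM; rewrite ?exprn_ge0//.
apply: lerXn2r; rewrite ?nnegrE ?mulr_ge0 ?invr_ge0 ?sqr_ge0//.
by rewrite mulrA ler_pdivlMr ?exprn_gt0// mulrC ler_wpM2r.
Qed.

(** Cauchy-Schwarz with weights 1/4, 1/2, 1/4. *)
Lemma sqrD3_le (x y z : R) :
  (x + (y + z)) ^+ 2 <= 4 * x ^+ 2 + 2 * y ^+ 2 + 4 * z ^+ 2.
Proof.
rewrite -subr_ge0.
have -> : 4 * x ^+ 2 + 2 * y ^+ 2 + 4 * z ^+ 2 - (x + (y + z)) ^+ 2 =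
  (2 * x - y) ^+ 2 / 2 + (2 * z - y) ^+ 2 / 2 + (x - z) ^+ 2 by field.
by rewrite !addr_ge0 ?divr_ge0 ?sqr_ge0.
Qed.

(** The coefficient of f^2 in the pointwise estimate, after |grad W|^2 has been
    replaced by its upper bound w (eps w^2 + E).  The powers of w left over from
    dcutoff_edge are at most w^p because w >= M >= 1. *)
Lemma cutoff_coef_le M dl p w (eps E : R) :
  1 <= M -> 0 <= dl -> M <= w -> 0 <= eps -> 0 <= E ->
  (2 * dcutoff_power M dl p w ^+ 2 + 4 * dcutoff_edge M dl p w ^+ 2) *
    (w * (eps * w ^+ 2 + E)) <=
  eps * (p%:R ^+ 2 / 2) * (w * cutoff M dl p w ^+ 2) +
  (E * (p%:R ^+ 2 / 2) + 16 * M ^+ 2 * (eps + E)) * w ^+ p.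
Proof.
move=> M1 dl0 Mw eps0 E0; have M0 : 0 <= M by exact: le_trans M1.
have w1 : 1 <= w by exact: le_trans Mw.
have w0 : 0 < w by exact: lt_le_trans w1.
have e : (2 * dcutoff_power M dl p w ^+ 2 + 4 * dcutoff_edge M dl p w ^+ 2) *
    (w * (eps * w ^+ 2 + E)) =
  2 * (w * dcutoff_power M dl p w) ^+ 2 * (eps * w + E / w) +
  4 * (w * dcutoff_edge M dl p w) ^+ 2 * (eps * w + E / w).
  by field; rewrite gt_eqF.
have Ew : E / w <= E by rewrite ler_pdivrMr// ler_peMr.
have hw0 : 0 <= eps * w + E / w.
  by apply: addr_ge0; [apply: mulr_ge0|apply: divr_ge0]; rewrite // ?ltW.
have pw0 : 0 <= w ^+ p by rewrite exprn_ge0// ltW.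
have p0 : 0 <= p%:R ^+ 2 / 2 :> R by rewrite divr_ge0 ?sqr_ge0.
rewrite e; apply: (@le_trans _ _
  (p%:R ^+ 2 / 2 * cutoff M dl p w ^+ 2 * (eps * w + E / w) +
   16 * (M / w) ^+ 2 * w ^+ p * (eps * w + E / w))).
  apply: lerD; apply: ler_wpM2r => //.
    have := dcutoff_power_sqr_le M p w0 dl0; lra.
  have := dcutoff_edge_sqr_le p M0 w0 dl0; lra.
have -> : eps * (p%:R ^+ 2 / 2) * (w * cutoff M dl p w ^+ 2) +
  (E * (p%:R ^+ 2 / 2) + 16 * M ^+ 2 * (eps + E)) * w ^+ p =
  (p%:R ^+ 2 / 2 * cutoff M dl p w ^+ 2 * (eps * w) +
   p%:R ^+ 2 / 2 * w ^+ p * E) + 16 * M ^+ 2 * w ^+ p * (eps + E) by ring.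
apply: lerD.
  rewrite mulrDr lerD2l; apply: ler_pM => //.
  - by apply: mulr_ge0 => //; exact: sqr_ge0.
  - by rewrite divr_ge0// ltW.
  by apply: ler_wpM2l => //; exact: cutoff_sqr_le.
have -> : 16 * (M / w) ^+ 2 * w ^+ p * (eps * w + E / w) =
  16 * M ^+ 2 * w ^+ p * (eps / w + E / w / w / w).
  by field; rewrite gt_eqF.
apply: ler_wpM2l; first by rewrite !mulr_ge0 ?sqr_ge0.
have d_le (t : R) : 0 <= t -> t / w <= t by move=> t0; rewrite ler_pdivrMr// ler_peMr.
apply: lerD; first exact: d_le.
have E1 : 0 <= E / w by rewrite divr_ge0// ltW.
have E2 : 0 <= E / w / w by rewrite divr_ge0// ltW.
exact: le_trans (d_le _ E2) (le_trans (d_le _ E1) (d_le _ E0)).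
Qed.

End Cutoff.
(** * Boundedness of homogeneous balls *)

Section HomogeneousBall.
Context {R : realType} {N : nat} (G : homogeneousGroup R N).
Local Notation V := 'rV[R]_N.

Lemma mx_norm_row_le (x : V) (b : R) : 0 <= b ->
  (`|x| <= b) <-> (forall j, `|x ord0 j| <= b).
Proof.
move=> b0; rewrite [`|x|]mx_normrE; split=> [h j|h].
  apply: le_trans h.
  exact: (@le_bigmax _ _ _ 0 (fun ij : 'I_1 * 'I_N => `|x ij.1 ij.2|) (ord0, j)).
by apply/bigmax_leP; split=> // -[i j] _ /=; rewrite (ord1 i).
Qed.

Lemma compact_sphere (b : R) : compact [set x : V | `|x| = b].
Proof.
apply: bounded_closed_compact.
  by exists b; rewrite num_real; split=> // c bc x /= ->; exact: ltW.
apply: (@preimage_closed _ _ (fun x : V => `|x|) [set b]); last exact: closed_eq.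
by move=> x _; exact: norm_continuous.
Qed.

(** The dilation factor T is the homogeneous quasi-norm
    max_j |x_j|^(1/w_j), where w_j is the weight of the j-th coordinate. *)
Lemma dilate_to_sphere (x : V) : x != 0 ->
  exists2 T : R, 0 < T & `|diag_dilation (weight G) T^-1 x| = 1 /\
    forall j, `|x ord0 j| <= T `^ weight G j.
Proof.
move=> x0; have [j0 xj0] : exists j, x ord0 j != 0.
  apply: contrapT => /forallNP h; move/eqP: x0; apply; apply/rowP => j.
  by rewrite mxE; apply/eqP; move/negP: (h j); rewrite negbK.
pose F j := `|x ord0 j| `^ (weight G j)^-1.
have w0 j : 0 < weight G j := weight_gt0 G j.
case: (@arg_maxP _ _ _ j0 xpredT F isT) => j1 _ hmax.
have T0 : 0 < F j1.
  by apply: lt_le_trans (hmax j0 isT); apply: powR_gt0; rewrite normr_gt0.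
have xF j : `|x ord0 j| = F j `^ weight G j.
  by rewrite /F -powRrM mulVf ?powRr1// gt_eqF.
have xT j : `|x ord0 j| <= F j1 `^ weight G j.
  rewrite xF; apply: ge0_ler_powR; rewrite ?nnegrE ?powR_ge0// ?(ltW (w0 _))//.
  exact: hmax.
exists (F j1) => //; split=> //.
have eT j : `|diag_dilation (weight G) (F j1)^-1 x ord0 j| =
    (F j1)^-1 `^ weight G j * `|x ord0 j|.
  by rewrite mxE normrM ger0_norm// powR_ge0.
have TT j : (F j1)^-1 `^ weight G j * F j1 `^ weight G j = 1.
  rewrite -powRM ?invr_ge0 ?ltW// mulVf ?gt_eqF//.
  by rewrite powR1.
apply/eqP; rewrite eq_le; apply/andP; split.
  apply/mx_norm_row_le => // j; rewrite eT -(TT j).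
  by rewrite ler_wpM2l// powR_ge0.
by rewrite -(TT j1) -xF -eT; exact: (proj1 (mx_norm_row_le _ (normr_ge0 _)) (lexx _)).
Qed.

(** On the unit sphere of the sup norm, nu is at least some c > 0 by
    compactness; dilating x to the sphere bounds the dilation factor by r/c. *)
Lemma hball_bounded (nu : V -> R) (r : R) : homogeneous_norm G nu ->
  exists B : R, forall x, hball nu r x -> `|x| <= B.
Proof.
move=> [cnu nu0 nu_eq0 nuZ].
have [c c0 hc] : exists2 c : R, 0 < c & forall y : V, `|y| = 1 -> c <= nu y.
  have [[y0 hy0]|/set0P/negP] := pselect ([set x : V | `|x| = 1] !=set0); last first.
    rewrite negbK => /eqP e; exists 1 => // y y1.
    by have : [set x : V | `|x| = 1] y by []; rewrite e.
  have [||y hy hmin] := @compact_EVT_min _ _ nu _ _ (@compact_sphere 1).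
  - by exists y0.
  - exact: continuous_subspaceT.
  exists (nu y).
    rewrite lt_neqAle nu0 andbT eq_sym; apply/eqP => /nu_eq0 y0'.
    move: hy; rewrite inE/= y0' normr0 => /esym/eqP.
    by rewrite oner_eq0.
  by move=> z z1; apply: hmin; rewrite inE.
exists (\sum_j (`|r| / c) `^ weight G j) => x xr.
have [->|x0] := eqVneq x 0.
  by rewrite normr0 sumr_ge0// => j _; exact: powR_ge0.
have [T T0 [yT xT]] := dilate_to_sphere x0.
have Tle : T <= `|r| / c.
  rewrite ler_pdivlMr// mulrC -ler_pdivlMr// mulrC.
  apply: le_trans (hc _ yT) _; rewrite nuZ ?invr_gt0// ler_pM2l ?invr_gt0//.
  exact: le_trans (ltW xr) (ler_norm r).
apply/mx_norm_row_le => [|j].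
  by rewrite sumr_ge0// => j _; exact: powR_ge0.
rewrite (bigD1 j)//= -[leLHS]addr0; apply: lerD.
  apply: (le_trans (xT j)); apply: ge0_ler_powR; rewrite ?nnegrE ?(ltW T0)//.
    by rewrite ltW// weight_gt0.
  by rewrite divr_ge0// ltW.
by rewrite sumr_ge0// => k _; exact: powR_ge0.
Qed.

Lemma continuous_hball_bounded (nu : V -> R) (r : R) (W : V -> R) :
  homogeneous_norm G nu -> continuous W ->
  exists2 M : R, 1 <= M & forall x, hball nu r x -> W x <= M.
Proof.
move=> hnu cW; have [B hB] := hball_bounded r hnu.
have cB : compact [set x : V | `|x| <= B].
  apply: bounded_closed_compact.
    exists B; rewrite num_real; split=> // c bc x /= h.
    exact: le_trans h (ltW bc).
  apply: (@preimage_closed _ _ (fun x : V => `|x|) [set y | y <= B]).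
    by move=> x _; exact: norm_continuous.
  exact: closed_le.
have [[x0 hx0]|h] := pselect ([set x : V | `|x| <= B] !=set0).
  have [||y hy hmax] := @compact_EVT_max _ _ W _ _ cB.
  - by exists x0.
  - exact: continuous_subspaceT.
  exists (Num.max 1 (W y)); first by rewrite le_max lexx.
  by move=> x /hB xB; rewrite le_max hmax ?orbT// inE.
by exists 1 => // x /hB xB; exfalso; apply: h; exists x.
Qed.

End HomogeneousBall.
(** * Measurability and derivatives along one-parameter subgroups *)

Section BorelFunctions.
Context {R : realType} {N : nat}.
Local Notation V := 'rV[R]_N.

Lemma continuous_measurable_borelV_real (f : V -> R) : continuous f ->
  measurable_fun [set: borelV R N] (f : borelV R N -> R).
Proof.
move=> /continuousP cf; apply: (measurability _ (RGenOpens.measurableE R)).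
move=> _ [_ [a [b ->] <-]]; rewrite setTI; apply: sub_sigma_algebra.
by apply: cf; exact: interval_open.
Qed.

Lemma continuous_measurable_borelV (f : V -> V) : continuous f ->
  measurable_fun [set: borelV R N] (f : borelV R N -> borelV R N).
Proof.
move=> /continuousP cf.
apply: (@measurability _ _ (borelV R N) (borelV R N) _ _ (@open V)) => //.
by move=> _ [A oA <-]; rewrite setTI; apply: sub_sigma_algebra; exact: cf.
Qed.

End BorelFunctions.

Section LeftInvariantDerivatives.
Context {R : realType} {N : nat} (G : homogeneousGroup R N).
Local Notation V := 'rV[R]_N.
Implicit Types (f W : V -> R) (g : R -> V) (x : V).

Lemma gmul_differentiable (z : V * V) :
  differentiable (fun z : V * V => gmul G z.1 z.2) z.
Proof. by have [] := gmul_smooth G 1. Qed.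

Lemma continuous_gmulr (y : V) : continuous (fun x => gmul G x y).
Proof.
move=> x; apply: differentiable_continuous.
apply: (@differentiable_comp _ _ _ _ (fun x => (x, y))
  (fun z : V * V => gmul G z.1 z.2)) => //; exact: gmul_differentiable.
Qed.

Lemma one_parameter_subgroup0 g : one_parameter_subgroup G g -> g 0 = 0.
Proof.
move=> [gD _]; have /(congr1 (gmul G (ginv G (g 0)))) := gD 0 0.
by rewrite addr0 gmulA gVmul g0mul.
Qed.

Lemma along0 g f x : one_parameter_subgroup G g -> along G g f x 0 = f x.
Proof. by move=> hg; rewrite /along one_parameter_subgroup0// gmul0. Qed.

Lemma derivable_along g W x : one_parameter_subgroup G g ->
  (forall y, differentiable W y) -> derivable (along G g W x) 0 1.
Proof.
move=> [_ dg] dW; apply/derivable1_diffP.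
apply: (@differentiable_comp _ _ _ _ (fun t => gmul G x (g t)) W) => //.
apply: (@differentiable_comp _ _ _ _ (fun t => (x, g t))
  (fun z : V * V => gmul G z.1 z.2)); last exact: gmul_differentiable.
apply: differentiable_pair => //.
by apply/derivable1_diffP.
Qed.

(** The derivative is the limit of the difference quotients with step
    1/(n+1). *)
Lemma measurable_lderive g f : one_parameter_subgroup G g ->
  measurable_fun [set: borelV R N] (f : borelV R N -> R) ->
  (forall x, derivable (along G g f x) 0 1) ->
  measurable_fun [set: borelV R N] (lderive G g f : borelV R N -> R).
Proof.
move=> hg mf df.
pose h (n : nat) : borelV R N -> R := fun x =>
  n.+1%:R * (f (gmul G x (g n.+1%:R^-1)) - f x).
apply: (@measurable_fun_cvg _ _ _ _ h) => [n|x _].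
  apply: measurable_funM => //; apply: measurable_funB => //.
  have mg := continuous_measurable_borelV (@continuous_gmulr (g n.+1%:R^-1)).
  exact: measurableT_comp mf mg.
have := df x; rewrite /derivable => /cvg_ex[l hl].
have -> : lderive G g f x = l by rewrite /lderive derive1E; exact: cvg_lim.
have hn : (n.+1%:R^-1 : R) @[n --> \oo] --> (0 : R)^'.
  move=> A A0; change (\forall n \near \oo, A (n.+1%:R^-1)).
  have h1 : \forall n \near \oo, n.+1%:R^-1 != 0 :> R -> A (n.+1%:R^-1).
    exact: @cvg_harmonic R _ A0.
  by apply: filterS h1 => n; apply; rewrite invr_eq0 pnatr_eq0.
have := cvg_comp _ _ hn hl; apply: cvg_trans; apply: near_eq_cvg.
near=> n; rewrite /h /= invrK along0// /along addr0 /GRing.scale/= mulr1.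
by [].
Unshelve. all: by end_near. Qed.

End LeftInvariantDerivatives.
(** * Iterated sub-gradients *)

Section IteratedSubgradient.
Context {R : realType} {N d : nat} (G : homogeneousGroup R N).
Local Notation V := 'rV[R]_N.
Variable g : 'I_d -> R -> V.
Hypothesis hg : forall i, one_parameter_subgroup G (g i).
Implicit Types (f W : V -> R) (x : V).

(** The integrand of the right-hand side: the sum over k <= m of the squared
    lengths of the k-fold sub-gradients, the term k = 0 being f^2. *)
Definition sobolev_density (m : nat) f x : R :=
  \sum_(0 <= k < m.+1) subgradn_sq G g k f x.

Lemma subgrad_defined_le m n f : (m <= n)%N ->
  subgrad_defined G g n f -> subgrad_defined G g m f.
Proof.
by move=> mn [mf df]; split=> // I i x Im; apply: df; exact: leq_trans Im mn.
Qed.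

Lemma measurable_lderives m f (I : seq 'I_d) : subgrad_defined G g m f ->
  (size I <= m)%N ->
  measurable_fun [set: borelV R N] (lderives G g I f : borelV R N -> R).
Proof.
move=> [mf df]; elim: I => //= i I ih Im.
apply: measurable_lderive => //; first exact: ih (ltnW Im).
by move=> x; exact: df.
Qed.

Lemma subgrad_defined_lderive m f i : subgrad_defined G g m.+1 f ->
  subgrad_defined G g m (lderive G (g i) f).
Proof.
move=> df; split; first exact: (@measurable_lderives m.+1 f [:: i]).
move=> I j x Im; have := (proj2 df) (rcons I i) j x.
by rewrite size_rcons /lderives foldr_rcons; exact.
Qed.

Lemma subgradn_sq_ge0 k f x : 0 <= subgradn_sq G g k f x.
Proof. by apply: sumr_ge0 => I _; exact: sqr_ge0. Qed.

Lemma subgrad_sq_ge0 f x : 0 <= subgrad_sq G g f x.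
Proof. by apply: sumr_ge0 => I _; exact: sqr_ge0. Qed.

Lemma measurable_subgradn_sq m k f : subgrad_defined G g m f -> (k <= m)%N ->
  measurable_fun [set: borelV R N] (subgradn_sq G g k f : borelV R N -> R).
Proof.
move=> df km; apply: measurable_sum => I; apply: measurable_funX.
by apply: measurable_lderives df _; rewrite size_tuple.
Qed.

Lemma measurable_subgrad_sq f : subgrad_defined G g 1 f ->
  measurable_fun [set: borelV R N] (subgrad_sq G g f : borelV R N -> R).
Proof.
move=> df; apply: measurable_sum => i; apply: measurable_funX.
exact: (@measurable_lderives 1 f [:: i]).
Qed.

Lemma sobolev_density_ge0 m f x : 0 <= sobolev_density m f x.
Proof. by apply: sumr_ge0 => k _; exact: subgradn_sq_ge0. Qed.

Lemma measurable_sobolev_density m f : subgrad_defined G g m f ->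
  measurable_fun [set: borelV R N] (sobolev_density m f : borelV R N -> R).
Proof.
move=> df.
have -> : sobolev_density m f = fun x => \sum_(k < m.+1) subgradn_sq G g k f x.
  by apply/funext => x; rewrite /sobolev_density big_mkord.
apply: measurable_sum => k; apply: measurable_subgradn_sq df _.
by rewrite -ltnS.
Qed.

Lemma subgradn_sq0 f x : subgradn_sq G g 0 f x = f x ^+ 2.
Proof.
rewrite /subgradn_sq (eq_bigr (fun=> f x ^+ 2)) => [|I _].
  by rewrite sumr_const card_tuple expn0 mulr1n.
by rewrite (tuple0 I).
Qed.

Lemma sobolev_densityE m f x : sobolev_density m f x =
  \sum_(1 <= k < m.+1) subgradn_sq G g k f x + f x ^+ 2.
Proof.
by rewrite /sobolev_density big_ltn// subgradn_sq0 addrC.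
Qed.

Lemma sobolev_density_leS m f x :
  sobolev_density m f x <= sobolev_density m.+1 f x.
Proof.
by rewrite /sobolev_density [leRHS]big_nat_recr//= lerDl subgradn_sq_ge0.
Qed.

Lemma sqr_le_sobolev_density m f x : f x ^+ 2 <= sobolev_density m f x.
Proof.
rewrite sobolev_densityE lerDr.
by apply: sumr_ge0 => k _; exact: subgradn_sq_ge0.
Qed.

Lemma sum_tuple_rcons (T : finType) (k : nat) (F : seq T -> R) :
  \sum_(I : k.+1.-tuple T) F I = \sum_(t : T) \sum_(I : k.-tuple T) F (rcons I t).
Proof.
rewrite pair_big /=.
pose h (u : T * k.-tuple T) : k.+1.-tuple T := [tuple of rcons u.2 u.1].
have hinj : injective h.
  move=> [t I] [t' I'] /(congr1 val)/= /rcons_inj[/val_inj -> ->] //.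
have hbij : bijective h.
  by apply: inj_card_bij => //; rewrite card_prod !card_tuple expnS.
by rewrite (reindex h) //=; exact: onW_bij.
Qed.

(** The innermost derivative is the last index of the tuple, so that
    differentiating f first by X_i appends i at the end. *)
Lemma sum_subgradn_sq_lderive k f x :
  \sum_(i < d) subgradn_sq G g k (lderive G (g i) f) x = subgradn_sq G g k.+1 f x.
Proof.
rewrite [RHS](@sum_tuple_rcons _ k (fun I => lderives G g I f x ^+ 2)).
by apply: eq_bigr => i _; apply: eq_bigr => I _; rewrite /lderives foldr_rcons.
Qed.

Lemma sum_sobolev_density_lderive m f x :
  \sum_(i < d) sobolev_density m (lderive G (g i) f) x <= sobolev_density m.+1 f x.
Proof.
rewrite /sobolev_density exchange_big/= [leRHS]big_nat_recl//=.
under eq_bigr do rewrite sum_subgradn_sq_lderive.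
by rewrite lerDr subgradn_sq_ge0.
Qed.

End IteratedSubgradient.

(** * The pointwise gradient estimate *)

Section CutoffGradient.
Context {R : realType} {N d : nat} (G : homogeneousGroup R N).
Local Notation V := 'rV[R]_N.
Variable g : 'I_d -> R -> V.
Hypothesis hg : forall i, one_parameter_subgroup G (g i).
Implicit Types (f W : V -> R) (x : V).

Lemma is_derive_along_comp_mul i W f x (phi : R -> R) (c : R) :
  (forall y, differentiable W y) -> derivable (along G (g i) f x) 0 1 ->
  is_derive (W x) 1 phi c ->
  is_derive (0 : R) 1 (along G (g i) (fun y => phi (W y) * f y) x)
    (phi (W x) * lderive G (g i) f x + f x * (c * lderive G (g i) W x)).
Proof.
move=> dW df dphi.
have h1 : is_derive (0 : R) 1 (along G (g i) W x) (lderive G (g i) W x).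
  apply: DeriveDef; first exact: derivable_along.
  by rewrite /lderive derive1E.
have h2 : is_derive (0 : R) 1 (along G (g i) f x) (lderive G (g i) f x).
  by apply: DeriveDef => //; rewrite /lderive derive1E.
have h3 : is_derive (along G (g i) W x 0) 1 phi c by rewrite along0.
have h4 := is_deriveM (is_derive1_comp h3 h1) h2.
apply: (is_derive_eq h4).
by rewrite /= !along0 // /GRing.scale/=.
Qed.

Lemma is_derive_cutoff_comp_mul i W f x M dl p :
  (forall y, differentiable W y) -> derivable (along G (g i) f x) 0 1 ->
  0 < M -> 0 <= dl -> (0 < p)%N ->
  is_derive (0 : R) 1 (along G (g i) (fun y => cutoff M dl p (W y) * f y) x)
    (if W x <= M then 0 else cutoff M dl p (W x) * lderive G (g i) f x +
     f x * ((dcutoff_power M dl p (W x) + dcutoff_edge M dl p (W x)) *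
       lderive G (g i) W x)).
Proof.
move=> dW df M0 dl0 p0; case: ifPn => [WM|]; last first.
  rewrite -ltNge => WM; apply: is_derive_along_comp_mul => //.
  by apply: is_derive_cutoff_gt => //; exact: ltW.
have h := is_derive_along_comp_mul dW df (is_derive_cutoff_le M0 dl0 p0 WM).
by apply: (is_derive_eq h); rewrite cutoff_eq0//; ring.
Qed.

Lemma measurable_cutoff_comp W M dl p :
  (forall y, differentiable W y) -> 0 < M -> 0 < dl -> (0 < p)%N ->
  measurable_fun [set: borelV R N] (fun y : borelV R N => cutoff M dl p (W y)).
Proof.
move=> dW M0 dl0 p0; apply: continuous_measurable_borelV_real => x.
apply: (@continuous_comp _ _ _ W (cutoff M dl p)).
  exact: differentiable_continuous.
by apply: continuous_cutoff => //; exact: ltW.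
Qed.

Lemma subgrad_defined_cutoff_mul W f M dl p :
  (forall y, differentiable W y) -> 0 < M -> 0 < dl -> (0 < p)%N ->
  subgrad_defined G g 1 f ->
  subgrad_defined G g 1 (fun y => cutoff M dl p (W y) * f y).
Proof.
move=> dW M0 dl0 p0 [mf df]; split.
  by apply: measurable_funM => //; exact: measurable_cutoff_comp.
case=> // i x _.
have h := is_derive_cutoff_comp_mul dW (df [::] i x isT) M0 (ltW dl0) p0.
exact: (@ex_derive _ _ _ _ _ _ _ h).
Qed.

(** The second summand on the right has the coefficient eps p^2/2 of the
    quantity to be absorbed; the other two are of lower order in W. *)
Lemma subgrad_sq_cutoff_mul_le W f M dl p eps E x :
  (forall y, differentiable W y) -> (forall y, 0 <= W y) ->
  (forall i, derivable (along G (g i) f x) 0 1) ->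
  1 <= M -> 0 <= dl -> (0 < p)%N -> 0 <= eps -> 0 <= E ->
  (M < W x -> subgrad_sq G g W x <= W x * (eps * W x ^+ 2 + E)) ->
  subgrad_sq G g (fun y => cutoff M dl p (W y) * f y) x <=
    4 * (W x ^+ p * subgrad_sq G g f x) +
    eps * (p%:R ^+ 2 / 2) * (W x * (cutoff M dl p (W x) * f x) ^+ 2) +
    (E * (p%:R ^+ 2 / 2) + 16 * M ^+ 2 * (eps + E)) * (W x ^+ p * f x ^+ 2).
Proof.
move=> dW W0 df M1 dl0 p0 eps0 E0 hW; have M0 : 0 < M by exact: lt_le_trans M1.
have w0 : 0 <= W x := W0 x.
set w := W x in w0 *; set phi := cutoff M dl p.
have lE i : lderive G (g i) (fun y => phi (W y) * f y) x =
    if w <= M then 0 else phi w * lderive G (g i) f x +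
     f x * ((dcutoff_power M dl p w + dcutoff_edge M dl p w) *
       lderive G (g i) W x).
  rewrite /lderive derive1E.
  have h := is_derive_cutoff_comp_mul dW (df i) M0 dl0 p0.
  by rewrite (@derive_val _ _ _ _ _ _ _ h).
have C0 : 0 <= E * (p%:R ^+ 2 / 2) + 16 * M ^+ 2 * (eps + E).
  by rewrite !(addr_ge0, mulr_ge0, sqr_ge0, divr_ge0) ?(ltW M0).
have [wM|Mw] := leP w M.
  rewrite [leLHS]big1 => [|i _]; last by rewrite lE wM expr0n.
  have wp0 : 0 <= w ^+ p by exact: exprn_ge0.
  have q0 : 0 <= p%:R ^+ 2 / 2 :> R by rewrite divr_ge0// sqr_ge0.
  apply: addr_ge0; [apply: addr_ge0|]; apply: mulr_ge0 => //.
  - by apply: mulr_ge0 => //; exact: subgrad_sq_ge0.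
  - exact: mulr_ge0.
  - by apply: mulr_ge0 => //; exact: sqr_ge0.
  - by apply: mulr_ge0 => //; exact: sqr_ge0.
rewrite [leLHS](eq_bigr _ (fun i _ => congr1 (fun z => z ^+ 2) (lE i))).
rewrite [w <= M]leNgt Mw /=.
have hsum : \sum_(i < d) (phi w * lderive G (g i) f x +
     f x * ((dcutoff_power M dl p w + dcutoff_edge M dl p w) *
       lderive G (g i) W x)) ^+ 2 <=
   4 * phi w ^+ 2 * subgrad_sq G g f x +
   (2 * dcutoff_power M dl p w ^+ 2 + 4 * dcutoff_edge M dl p w ^+ 2) *
     subgrad_sq G g W x * f x ^+ 2.
  rewrite /subgrad_sq mulr_sumr mulr_sumr mulr_suml -big_split/=.
  apply: ler_sum => i _; rewrite !mulrDl mulrDr.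
  apply: le_trans (sqrD3_le _ _ _) _.
  by rewrite le_eqVlt; apply/orP; left; apply/eqP; ring.
apply: le_trans hsum _; rewrite -addrA; apply: lerD.
  rewrite -mulrA ler_wpM2l// ler_wpM2r ?subgrad_sq_ge0//.
  by apply: cutoff_sqr_le => //; [exact: ltW|exact: lt_trans Mw].
have -> : eps * (p%:R ^+ 2 / 2) * (w * (phi w * f x) ^+ 2) +
    (E * (p%:R ^+ 2 / 2) + 16 * M ^+ 2 * (eps + E)) * (w ^+ p * f x ^+ 2) =
  (eps * (p%:R ^+ 2 / 2) * (w * phi w ^+ 2) +
  (E * (p%:R ^+ 2 / 2) + 16 * M ^+ 2 * (eps + E)) * w ^+ p) * f x ^+ 2 by ring.
apply: ler_wpM2r; first exact: sqr_ge0.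
apply: le_trans (cutoff_coef_le p M1 dl0 (ltW Mw) eps0 E0).
apply: ler_wpM2l; last exact: hW.
by apply: addr_ge0; apply: mulr_ge0 => //; exact: sqr_ge0.
Qed.

End CutoffGradient.
(** * Integrals of nonnegative real functions *)

Section NonnegativeRealIntegrals.
Context {d : measure_display} {T : measurableType d} {R : realType}.
Variable mu : {measure set T -> \bar R}.
Implicit Types h : T -> R.
Local Open Scope ereal_scope.

Lemma integral_EFin_le h1 h2 :
  measurable_fun setT h1 -> measurable_fun setT h2 ->
  (forall x, 0 <= h1 x)%R -> (forall x, h1 x <= h2 x)%R ->
  \int[mu]_x (h1 x)%:E <= \int[mu]_x (h2 x)%:E.
Proof.
move=> m1 m2 h10 h12; apply: ge0_le_integral => //.
- by move=> x _; rewrite lee_fin.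
- exact/measurable_EFinP.
- exact/measurable_EFinP.
- by move=> x _; rewrite lee_fin.
Qed.

Lemma integral_EFin_add h1 h2 :
  measurable_fun setT h1 -> measurable_fun setT h2 ->
  (forall x, 0 <= h1 x)%R -> (forall x, 0 <= h2 x)%R ->
  \int[mu]_x (h1 x + h2 x)%:E = \int[mu]_x (h1 x)%:E + \int[mu]_x (h2 x)%:E.
Proof.
move=> m1 m2 h10 h20.
under eq_integral do rewrite EFinD.
apply: ge0_integralD => //.
- by move=> x _; rewrite lee_fin.
- exact/measurable_EFinP.
- by move=> x _; rewrite lee_fin.
- exact/measurable_EFinP.
Qed.

Lemma integral_EFin_scale (c : R) h : measurable_fun setT h ->
  (forall x, 0 <= h x)%R -> (0 <= c)%R ->
  \int[mu]_x (c * h x)%:E = c%:E * \int[mu]_x (h x)%:E.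
Proof.
move=> mh h0 c0; under eq_integral do rewrite EFinM.
apply: ge0_integralZl_EFin => //.
- by move=> x _; rewrite lee_fin.
- exact/measurable_EFinP.
Qed.

Lemma integral_EFin_sum n (h : 'I_n -> T -> R) :
  (forall i, measurable_fun setT (h i)) -> (forall i x, 0 <= h i x)%R ->
  \int[mu]_x (\sum_(i < n) h i x)%:E = \sum_(i < n) \int[mu]_x (h i x)%:E.
Proof.
move=> mh h0; under eq_integral do rewrite -sumEFin.
apply: ge0_integral_sum => //.
- by move=> i; exact/measurable_EFinP.
- by move=> i x _; rewrite lee_fin.
Qed.

Lemma integral_EFin_ge0 h : (forall x, 0 <= h x)%R -> 0 <= \int[mu]_x (h x)%:E.
Proof. by move=> h0; apply: integral_ge0 => x _; rewrite lee_fin. Qed.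

Lemma integral_le_sublevels h (W : T -> R) (c : \bar R) :
  measurable_fun setT h -> measurable_fun setT W -> (forall x, 0 <= h x)%R ->
  (forall k : nat, \int[mu]_(x in [set x | W x <= k.+1%:R]%R) (h x)%:E <= c) ->
  \int[mu]_x (h x)%:E <= c.
Proof.
move=> mh mW h0 hk; pose D (k : nat) := [set x | W x <= k.+1%:R]%R.
have mD k : measurable (D k).
  by rewrite /D -[X in measurable X]setTI; exact: measurable_fun_le.
have DU : \bigcup_k D k = setT.
  apply/seteqP; split=> // x _; exists (Num.truncn (W x))%R => //=.
  exact: ltW (truncnS_gt _).
have nD : nondecreasing_seq D.
  move=> m n mn; apply/subsetPset => x /=; rewrite /D/= => /le_trans; apply.
  by rewrite ler_nat ltnS.
have := @ge0_nondecreasing_set_cvg_integral _ _ _ D (fun x => (h x)%:E) mu nD mD.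
have mhD k : measurable_fun (D k) (fun x => (h x)%:E).
  by apply/measurable_EFinP; exact: measurable_funTS.
have h0D k x : D k x -> 0 <= (h x)%:E by rewrite lee_fin.
rewrite DU => /(_ mhD h0D) cv; rewrite -(cvg_lim _ cv)//.
apply: lime_le; first by apply/cvg_ex; eexists; exact: cv.
by apply: nearW => k; exact: hk.
Qed.

Lemma absorb_le (i b : \bar R) (t : R) : (t < 1)%R -> i \is a fin_num ->
  i <= t%:E * i + b -> i <= (1 - t)^-1%:E * b.
Proof.
move=> t1; case: i => // i _; have t0 : (0 < 1 - t)%R by rewrite subr_gt0.
case: b => [b| |].
- rewrite -!EFinM -EFinD !lee_fin => h; rewrite ler_pdivlMl//; lra.
- by move=> _; rewrite gt0_muley ?lte_fin ?invr_gt0// leey.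
- by rewrite -EFinM addeNy leeNy_eq.
Qed.

End NonnegativeRealIntegrals.
(** * Bounds for powers of W *)

Section PowersOfW.
Context {R : realType} {N d : nat} (G : homogeneousGroup R N).
Local Notation V := 'rV[R]_N.
Variable g : 'I_d -> R -> V.
Hypothesis hg : forall i, one_parameter_subgroup G (g i).
Variables (mu : probability (borelV R N) R) (W : V -> R) (a : R).
Hypothesis hW0 : forall x, 0 <= W x.
Hypothesis hW : forall x, differentiable W x.
Hypothesis ha : 0 < a.
Hypothesis hUbound : forall f : V -> R, subgrad_defined G g 1 f ->
  (\int[mu]_x (W x * f x ^+ 2)%:E <=
   a%:E * (\int[mu]_x (subgrad_sq G g f x)%:E + \int[mu]_x (f x ^+ 2)%:E))%E.

(** The conclusion of the theorem for the exponent m with constant A. *)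
Definition power_bound (m : nat) (A : R) : Prop :=
  forall f : V -> R, subgrad_defined G g m f ->
    (\int[mu]_x (W x ^+ m * f x ^+ 2)%:E <=
     A%:E * \int[mu]_x (sobolev_density G g m f x)%:E)%E.

Local Notation mfun f := (measurable_fun [set: borelV R N] (f : borelV R N -> R)).

Lemma measurable_W : mfun W.
Proof.
apply: continuous_measurable_borelV_real => x.
exact: differentiable_continuous.
Qed.

Lemma measurable_powW_sqr m f : mfun f -> mfun (fun x => W x ^+ m * f x ^+ 2).
Proof.
move=> mf; apply: measurable_funM; apply: measurable_funX => //.
exact: measurable_W.
Qed.

Lemma powW_sqr_ge0 m (f : V -> R) x : 0 <= W x ^+ m * f x ^+ 2.
Proof. by rewrite mulr_ge0 ?sqr_ge0 ?exprn_ge0. Qed.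

(** The bound for the exponent p, applied to all the X_i f. *)
Lemma power_bound_subgrad p A f : 0 <= A -> power_bound p A ->
  subgrad_defined G g p.+1 f ->
  (\int[mu]_x (W x ^+ p * subgrad_sq G g f x)%:E <=
   A%:E * \int[mu]_x (sobolev_density G g p.+1 f x)%:E)%E.
Proof.
move=> A0 hA df.
have dfi i := subgrad_defined_lderive hg i df.
have -> : (\int[mu]_x (W x ^+ p * subgrad_sq G g f x)%:E =
    \sum_(i < d) \int[mu]_x (W x ^+ p * lderive G (g i) f x ^+ 2)%:E)%E.
  rewrite -integral_EFin_sum => [|i|i x]; first 1 last.
  - by apply: measurable_powW_sqr; exact: (proj1 (dfi i)).
  - exact: powW_sqr_ge0.
  by apply: eq_integral => x _; rewrite mulr_sumr.
apply: (@le_trans _ _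
  (\sum_(i < d) A%:E * \int[mu]_x (sobolev_density G g p (lderive G (g i) f) x)%:E)%E).
  by apply: lee_sum => i _; exact: hA.
have ms i : mfun (sobolev_density G g p (lderive G (g i) f)).
  exact: measurable_sobolev_density.
rewrite -ge0_sume_distrr => [|i _]; last first.
  by apply: integral_EFin_ge0 => x; exact: sobolev_density_ge0.
rewrite -integral_EFin_sum//; last by move=> i x; exact: sobolev_density_ge0.
apply: lee_wpmul2l; first by rewrite lee_fin.
apply: integral_EFin_le.
- exact: measurable_sum.
- exact: measurable_sobolev_density.
- by move=> x; apply: sumr_ge0 => i _; exact: sobolev_density_ge0.
- by move=> x; exact: sum_sobolev_density_lderive.
Qed.

Lemma power_bound_lower p A f : 0 <= A -> power_bound p A ->
  subgrad_defined G g p.+1 f ->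
  (\int[mu]_x (W x ^+ p * f x ^+ 2)%:E <=
   A%:E * \int[mu]_x (sobolev_density G g p.+1 f x)%:E)%E.
Proof.
move=> A0 hA df; have dfp := subgrad_defined_le (leqnSn p) df.
apply: le_trans (hA _ dfp) _; apply: lee_wpmul2l; first by rewrite lee_fin.
apply: integral_EFin_le.
- exact: measurable_sobolev_density.
- exact: measurable_sobolev_density.
- by move=> x; exact: sobolev_density_ge0.
- by move=> x; exact: sobolev_density_leS.
Qed.

Section Truncated.
Variables (eps E M : R).
Hypothesis heps : 0 < eps.
Hypothesis hE : 0 < E.
Hypothesis hM : 1 <= M.
Hypothesis hgrad : forall x, M < W x ->
  subgrad_sq G g W x <= W x * (eps * W x ^+ 2 + E).

(** The function phi(W) f to which the hypothesis on mu (W f^2) is applied. *)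
Definition truncated p dl (f : V -> R) : V -> R :=
  fun x => cutoff M dl p (W x) * f x.

Lemma truncated_sqr_le p dl f x : (0 < p)%N -> 0 < dl ->
  truncated p dl f x ^+ 2 <= W x ^+ p * f x ^+ 2.
Proof.
move=> p0 dl0; have M0 : 0 < M by exact: lt_le_trans hM.
rewrite exprMn; apply: ler_wpM2r; first exact: sqr_ge0.
have [WM|MW] := leP (W x) M.
  by rewrite cutoff_eq0// expr0n/= exprn_ge0.
by apply: cutoff_sqr_le; [exact: ltW|exact: ltW|exact: lt_trans MW].
Qed.

Lemma truncated_integral_fin p dl f : (0 < p)%N -> 0 < dl ->
  subgrad_defined G g p.+1 f ->
  (\int[mu]_x (sobolev_density G g p.+1 f x)%:E < +oo)%E ->
  (\int[mu]_x (W x * truncated p dl f x ^+ 2)%:E)%E \is a fin_num.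
Proof.
move=> p0 dl0 df Sfin; have M0 : 0 < M by exact: lt_le_trans hM.
have mf := proj1 df.
have mt : mfun (truncated p dl f).
  by apply: measurable_funM => //; exact: measurable_cutoff_comp.
rewrite ge0_fin_numE; last first.
  by apply: integral_EFin_ge0 => x; rewrite mulr_ge0// sqr_ge0.
have c0 : 0 <= dl ^- p.+1 by rewrite invr_ge0 exprn_ge0// ltW.
apply: (@le_lt_trans _ _ ((dl ^- p.+1)%:E *
    \int[mu]_x (sobolev_density G g p.+1 f x)%:E)%E); last first.
  by apply: lte_mul_pinfty => //; rewrite lee_fin.
rewrite -integral_EFin_scale//; first 1 last.
- exact: measurable_sobolev_density.
- by move=> x; exact: sobolev_density_ge0.
apply: integral_EFin_le.
- apply: measurable_funM; first exact: measurable_W.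
  exact: measurable_funX.
- by apply: measurable_funM => //; exact: measurable_sobolev_density.
- by move=> x; rewrite mulr_ge0// sqr_ge0.
- move=> x; rewrite exprMn mulrA; apply: ler_pM.
  + by rewrite mulr_ge0// sqr_ge0.
  + exact: sqr_ge0.
  + by apply: mul_cutoff_sqr_le => //; exact: ltW.
  + exact: sqr_le_sobolev_density.
Qed.

(** The absorption step; the constant K does not depend on dl. *)
Lemma truncated_bound p A : (0 < p)%N -> 0 < A ->
  power_bound p A -> a * (eps * (p%:R ^+ 2 / 2)) < 1 ->
  exists2 K : R, 0 < K & forall dl f, 0 < dl -> subgrad_defined G g p.+1 f ->
    (\int[mu]_x (W x * truncated p dl f x ^+ 2)%:E <=
     K%:E * \int[mu]_x (sobolev_density G g p.+1 f x)%:E)%E.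
Proof.
move=> p0 A0 hA t1; have M0 : 0 < M by exact: lt_le_trans hM.
set th := eps * (p%:R ^+ 2 / 2) in t1 *.
have th0 : 0 <= th by rewrite /th mulr_ge0 ?divr_ge0 ?sqr_ge0 ?(ltW heps).
pose C := E * (p%:R ^+ 2 / 2) + 16 * M ^+ 2 * (eps + E).
have C0 : 0 < C.
  rewrite /C ltr_wpDl//.
    by apply: mulr_ge0; [exact: ltW|rewrite divr_ge0// sqr_ge0].
  by rewrite !mulr_gt0// ?exprn_gt0// addr_gt0.
exists ((1 - a * th)^-1 * (a * (4 * A + C * A + A))).
  by rewrite mulr_gt0 ?invr_gt0 ?subr_gt0// mulr_gt0// !addr_gt0// mulr_gt0.
move=> dl f dl0 df; have mf := proj1 df.
have K0 : 0 < (1 - a * th)^-1 * (a * (4 * A + C * A + A)).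
  by rewrite mulr_gt0 ?invr_gt0 ?subr_gt0// mulr_gt0// !addr_gt0// mulr_gt0.
have S0 : (0 <= \int[mu]_x (sobolev_density G g p.+1 f x)%:E)%E.
  by apply: integral_EFin_ge0 => x; exact: sobolev_density_ge0.
have := truncated_integral_fin p0 dl0 df.
set S := (\int[mu]_x (sobolev_density G g p.+1 f x)%:E)%E in S0 *.
(* If the right-hand side is infinite there is nothing to prove. *)
have [-> _|Sfin /(_ _)/wrap[]//] := eqVneq S +oo%E.
  by rewrite gt0_muley ?lte_fin// leey.
  by rewrite ltey.
set I := (\int[mu]_x (W x * truncated p dl f x ^+ 2)%:E)%E => Ifin.
have df1 : subgrad_defined G g 1 f by exact: subgrad_defined_le df.
have dt : subgrad_defined G g 1 (truncated p dl f).
  exact: subgrad_defined_cutoff_mul.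
have mt := proj1 dt.
have mgf : mfun (subgrad_sq G g f) by exact: measurable_subgrad_sq.
have mWg : mfun (fun x => W x ^+ p * subgrad_sq G g f x).
  by apply: measurable_funM => //; apply: measurable_funX; exact: measurable_W.
have mWt : mfun (fun x => W x * truncated p dl f x ^+ 2).
  by apply: measurable_funM; [exact: measurable_W|exact: measurable_funX].
have mWf : mfun (fun x => W x ^+ p * f x ^+ 2) by exact: measurable_powW_sqr.
have Wg0 x : 0 <= W x ^+ p * subgrad_sq G g f x.
  by rewrite mulr_ge0 ?exprn_ge0// subgrad_sq_ge0.
have Wt0 x : 0 <= W x * truncated p dl f x ^+ 2 by rewrite mulr_ge0 ?sqr_ge0.
have Wf0 x := powW_sqr_ge0 p f x.
have hgradt : (\int[mu]_x (subgrad_sq G g (truncated p dl f) x)%:E <=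
    4%:E * (A%:E * S) + th%:E * I + C%:E * (A%:E * S))%E.
  apply: (@le_trans _ _ (\int[mu]_x (4 * (W x ^+ p * subgrad_sq G g f x) +
      th * (W x * truncated p dl f x ^+ 2) + C * (W x ^+ p * f x ^+ 2))%:E)%E).
    apply: integral_EFin_le.
    - exact: measurable_subgrad_sq.
    - by apply: measurable_funD; [apply: measurable_funD|]; apply: measurable_funM.
    - by move=> x; exact: subgrad_sq_ge0.
    - move=> x; apply: subgrad_sq_cutoff_mul_le => //; try exact: ltW.
      + by move=> i; exact: (proj2 df1 [::]).
      + exact: hgrad.
  have h40 x : 0 <= 4 * (W x ^+ p * subgrad_sq G g f x) by rewrite mulr_ge0.
  have ht0 x : 0 <= th * (W x * truncated p dl f x ^+ 2) by rewrite mulr_ge0.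
  have hC0 x : 0 <= C * (W x ^+ p * f x ^+ 2) by rewrite mulr_ge0// ltW.
  rewrite integral_EFin_add; first 1 last.
  - by apply: measurable_funD; apply: measurable_funM.
  - exact: measurable_funM.
  - by move=> x; exact: addr_ge0.
  - by [].
  rewrite integral_EFin_add//; try exact: measurable_funM.
  rewrite !integral_EFin_scale// ?(ltW C0)//.
  apply: leeD; [apply: leeD => //|]; apply: lee_wpmul2l; rewrite ?lee_fin ?(ltW C0)//.
    by apply: power_bound_subgrad => //; exact: ltW.
  by apply: power_bound_lower => //; exact: ltW.
have hsq : (\int[mu]_x (truncated p dl f x ^+ 2)%:E <= A%:E * S)%E.
  apply: le_trans (power_bound_lower (ltW A0) hA df).
  apply: integral_EFin_le => //.
  - exact: measurable_funX.
  - by move=> x; exact: sqr_ge0.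
  - by move=> x; exact: truncated_sqr_le.
have Sf : S \is a fin_num by rewrite ge0_fin_numE// ltey.
rewrite EFinM -muleA; apply: absorb_le => //.
apply: le_trans (hUbound dt) _.
apply: (@le_trans _ _ (a%:E * ((4%:E * (A%:E * S) + th%:E * I + C%:E * (A%:E * S))
    + A%:E * S))%E).
  by apply: lee_wpmul2l; [rewrite lee_fin ltW|exact: leeD].
rewrite -(fineK Ifin) -(fineK Sf) -!(EFinM, EFinD) lee_fin.
by rewrite le_eqVlt; apply/orP; left; apply/eqP; ring.
Qed.

(** For W <= 2M the first summand suffices; for W >= 2M the cutoff factor
    (1 - M/W)^2 is at least 1/4 and 1 + W/(k+1) is at most 2. *)
Lemma powW_le_truncated p (k : nat) f x : W x <= k.+1%:R ->
  W x ^+ p.+1 * f x ^+ 2 <= (2 * M) ^+ p.+1 * f x ^+ 2 +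
    16 * 4 ^+ p * (W x * truncated p k.+1%:R^-1 f x ^+ 2).
Proof.
move=> Wk; have M0 : 0 < M by exact: lt_le_trans hM.
have c0 : 0 <= 16 * 4 ^+ p :> R by rewrite mulr_ge0// exprn_ge0.
have t0 : 0 <= 16 * 4 ^+ p * (W x * truncated p k.+1%:R^-1 f x ^+ 2).
  by apply: mulr_ge0 => //; apply: mulr_ge0 => //; exact: sqr_ge0.
have m0 : 0 <= 2 * M by rewrite mulr_ge0// ltW.
have [WM|/ltW MW] := leP (W x) (2 * M).
  rewrite -[leLHS]addr0; apply: lerD => //; apply: ler_wpM2r; first exact: sqr_ge0.
  by apply: lerXn2r; rewrite ?nnegrE.
have W0 : 0 < W x by apply: lt_le_trans MW; rewrite mulr_gt0.
rewrite -[leLHS]add0r; apply: lerD.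
  by apply: mulr_ge0; [exact: exprn_ge0|exact: sqr_ge0].
rewrite exprMn exprS.
have -> : 16 * 4 ^+ p * (W x * (cutoff M k.+1%:R^-1 p (W x) ^+ 2 * f x ^+ 2)) =
  W x * (16 * 4 ^+ p * cutoff M k.+1%:R^-1 p (W x) ^+ 2) * f x ^+ 2 by ring.
apply: ler_wpM2r; first exact: sqr_ge0.
apply: ler_wpM2l => //; apply: le_cutoff_sqr => //; first exact: ltW.
by rewrite ler_pdivrMl// mulr1.
Qed.

Lemma power_boundS p A : (0 < p)%N -> 0 < A ->
  power_bound p A -> a * (eps * (p%:R ^+ 2 / 2)) < 1 ->
  exists2 B : R, 0 < B & power_bound p.+1 B.
Proof.
move=> p0 A0 hA t1; have [K K0 hK] := truncated_bound p0 A0 hA t1.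
have M0 : 0 < M by exact: lt_le_trans hM.
have c0 : 0 < 16 * 4 ^+ p :> R by rewrite mulr_gt0// exprn_gt0.
have m0 : 0 < (2 * M) ^+ p.+1 by rewrite exprn_gt0// mulr_gt0.
exists ((2 * M) ^+ p.+1 + 16 * 4 ^+ p * K).
  by rewrite addr_gt0// mulr_gt0.
move=> f df; have mf := proj1 df.
apply: (@integral_le_sublevels _ (borelV R N) R mu
  (fun x => W x ^+ p.+1 * f x ^+ 2) W).
- exact: measurable_powW_sqr.
- exact: measurable_W.
- exact: powW_sqr_ge0.
move=> k; set S := (\int[mu]_x (sobolev_density G g p.+1 f x)%:E)%E.
have dl0 : 0 < k.+1%:R^-1 :> R by rewrite invr_gt0.
have mt : mfun (truncated p k.+1%:R^-1 f).
  by apply: measurable_funM => //; exact: measurable_cutoff_comp.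
pose u x := (2 * M) ^+ p.+1 * f x ^+ 2.
pose v x := 16 * 4 ^+ p * (W x * truncated p k.+1%:R^-1 f x ^+ 2).
have mf2 : mfun (fun x => f x ^+ 2) by exact: measurable_funX.
have mWt : mfun (fun x => W x * truncated p k.+1%:R^-1 f x ^+ 2).
  by apply: measurable_funM; [exact: measurable_W|exact: measurable_funX].
have mu_ : mfun u by exact: measurable_funM.
have mv : mfun v by exact: measurable_funM.
have f20 x : 0 <= f x ^+ 2 by exact: sqr_ge0.
have Wt0 x : 0 <= W x * truncated p k.+1%:R^-1 f x ^+ 2 by rewrite mulr_ge0 ?sqr_ge0.
have u0 x : 0 <= u x by rewrite mulr_ge0// ltW.
have v0 x : 0 <= v x by rewrite mulr_ge0// ltW.
have muv : mfun (fun x => u x + v x) by exact: measurable_funD.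
pose D : set (borelV R N) := [set x : borelV R N | W x <= k.+1%:R].
have mD : measurable D.
  rewrite /D -[X in measurable X]setTI.
  by apply: measurable_fun_le => //; exact: measurable_W.
apply: (@le_trans _ _ (\int[mu]_x (u x + v x)%:E)%E).
  apply: (@le_trans _ _ (\int[mu]_(x in D) (u x + v x)%:E)%E).
    apply: ge0_le_integral => //.
    - by move=> x _; rewrite lee_fin; exact: powW_sqr_ge0.
    - apply/measurable_EFinP; apply: measurable_funTS.
      exact: measurable_powW_sqr.
    - by apply/measurable_EFinP; exact: measurable_funTS.
    - by move=> x Wx; rewrite lee_fin; exact: powW_le_truncated.
  apply: ge0_subset_integral => //.
  - exact/measurable_EFinP.
  - by move=> x _; rewrite lee_fin addr_ge0.
rewrite integral_EFin_add// !integral_EFin_scale// ?(ltW m0) ?(ltW c0)//.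
rewrite EFinD ge0_muleDl ?lee_fin ?(ltW m0) ?mulr_ge0 ?(ltW c0) ?(ltW K0)//.
apply: leeD.
  apply: lee_wpmul2l; first by rewrite lee_fin ltW.
  apply: integral_EFin_le => //; first exact: measurable_sobolev_density.
  by move=> x; exact: sqr_le_sobolev_density.
rewrite [(_ * K)%:E]EFinM -muleA; apply: lee_wpmul2l; first by rewrite lee_fin ltW.
exact: hK.
Qed.

End Truncated.
End PowersOfW.
Unset Implicit Arguments.

Theorem theorem3 (R : realType) (N d : nat) (G : homogeneousGroup R N)
  (nu : 'rV[R]_N -> R) (g : 'I_d -> R -> 'rV[R]_N)
  (lambda : {measure set (borelV R N) -> \bar R})
  (U : 'rV[R]_N -> R) (mu : probability (borelV R N) R)
  (W : 'rV[R]_N -> R) (a : R) (n : nat) (r eps E_eps : R)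
  (hnu : homogeneous_norm G nu)
  (hg : forall i, one_parameter_subgroup G (g i))
  (hgen : generating G g)
  (hlambda : haar_measure G lambda)
  (hmu : has_density lambda U mu)
  (hW0 : forall x, 0 <= W x)
  (hW : forall x, differentiable W x)
  (ha : 0 < a)
  (hUbound : forall f : 'rV[R]_N -> R, subgrad_defined G g 1 f ->
    (\int[mu]_x (W x * f x ^+ 2)%:E <=
     a%:E * (\int[mu]_x (subgrad_sq G g f x)%:E + \int[mu]_x (f x ^+ 2)%:E))%E)
  (hr : 0 < r) (heps : 0 < eps) (hE : 0 < E_eps)
  (hgrad : forall x, ~ hball nu r x -> W x != 0 ->
    (W x)^-1 * subgrad_sq G g W x <= eps * W x ^+ 2 + E_eps)
  (hsmall : eps * a * (n%:R ^+ 2 / 2) < 1) :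
  forall m : nat, (m <= n)%N ->
  exists a_m : R, 0 < a_m /\
  forall f : 'rV[R]_N -> R, subgrad_defined G g m f ->
    (\int[mu]_x (W x ^+ m * f x ^+ 2)%:E <=
     a_m%:E *
     \int[mu]_x (\sum_(1 <= k < m.+1) subgradn_sq G g k f x + f x ^+ 2)%:E)%E.
Proof.
move=> m mn.
suff [A A0 hA] : exists2 A : R, 0 < A & power_bound G g mu W m A.
  exists A; split=> // f df; have := hA f df.
  by under [X in (_ <= _ * X)%E -> _]eq_integral do rewrite sobolev_densityE.
have cW : continuous W by move=> x; exact: differentiable_continuous.
have [M M1 hM] := continuous_hball_bounded r hnu cW.
have hgradM x : M < W x ->
    subgrad_sq G g W x <= W x * (eps * W x ^+ 2 + E_eps).
  move=> MW; have W0 : 0 < W x by apply: lt_trans MW; exact: lt_le_trans M1.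
  (* A point with W > M lies outside the ball, and there W != 0. *)
  rewrite -ler_pdivrMl//; apply: hgrad; last by rewrite gt_eqF.
  by move=> /hM; rewrite leNgt MW.
elim: m mn => [_|p ih pn].
  exists 1 => // f df; rewrite mul1e; under eq_integral do rewrite expr0 mul1r.
  apply: integral_EFin_le => [|||x].
  - by apply: measurable_funX; exact: (proj1 df).
  - exact: measurable_sobolev_density.
  - by move=> x; exact: sqr_ge0.
  - exact: sqr_le_sobolev_density.
have [A A0 hA] := ih (ltnW pn).
(* The cutoff argument needs p > 0; the exponent 1 is the hypothesis itself. *)
have [->|p0] := posnP p.
  exists a => // f df; have mf := proj1 df; under eq_integral do rewrite expr1.
  apply: le_trans (hUbound f df) _.
  rewrite -integral_EFin_add.
  - apply: lee_wpmul2l; first by rewrite lee_fin ltW.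
    apply: integral_EFin_le => [|||x].
    + apply: measurable_funD; last exact: measurable_funX.
      exact: measurable_subgrad_sq.
    + exact: measurable_sobolev_density.
    + by move=> x; rewrite addr_ge0 ?sqr_ge0 ?subgrad_sq_ge0.
    + rewrite /sobolev_density big_nat_recl// big_nat1 subgradn_sq0 addrC lerD2l.
      rewrite -(sum_subgradn_sq_lderive G g 0 f x).
      by apply: ler_sum => i _; rewrite subgradn_sq0.
  - exact: measurable_subgrad_sq.
  - exact: measurable_funX.
  - by move=> x; exact: subgrad_sq_ge0.
  - by move=> x; exact: sqr_ge0.
apply: (power_boundS hg hW0 hW ha hUbound heps hE M1 hgradM p0 A0 hA).
apply: le_lt_trans hsmall.
rewrite mulrA [a * eps]mulrC; apply: ler_wpM2l; first by rewrite mulr_ge0// ltW.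
apply: ler_wpM2r; first by rewrite invr_ge0.
by apply: lerXn2r; rewrite ?nnegrE// ler_nat ltnW.
Qed.
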